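(* Let $k \geq 2$ and $t \geq 0$ be integers and let $\varphi(k,t) = t(k-1)^2 + k-1$. If $G \in \mathcal{C}(k,t)$, then $\iota(G) < \frac{1}{2} + \frac{1}{4k\,\varphi(k,t) + 2}$.
   Context: All graphs are finite and simple. $d_G(v)$ is the degree of $v$ in $G$, $\Delta(G)$ and $\delta(G)$ are the maximum and minimum degree, and $V_i(G)=\{v\in V(G) : d_G(v)=i\}$. $\chi'(G)$ is the chromatic index (least number of colors in a proper edge-coloring). For $k \geq 2$, a connected graph $G$ is $k$-critical if $\Delta(G)=k$, $\chi'(G)=k+1$ and $\chi'(G-e)=k$ for every $e \in E(G)$. $\alpha(G)$ is the maximum cardinality of an independent set of vertices of $G$, and $\iota(G)=\alpha(G)/|V(G)|$. For integers $k \geq 2$ and $t \geq 0$, $\mathcal{C}(k,t)$ is the set of $k$-critical graphs $G$ such that: (1) $\delta(G)\geq k-1$; (2) to each $v \in V_{k-1}(G)$ one can assign $k-1$ (distinguished) paths $p^t_1(v),\dots,p^t_{k-1}(v)$ in $G$ with initial vertex $v$, such that for all $v\in V_{k-1}(G)$ and all $i,j\in\{1,\dots,k-1\}$: (a) $V(p^t_i(v))\cap V_{k-1}(G)=\{v\}$; (b) $|V(p^t_i(v))|\geq 2t(k-1)+2$; (c) if $i\neq j$, then $V(p^t_i(v))\cap V(p^t_j(v))=\{v\}$; (d) if $w\in V_{k-1}(G)$ and $w\neq v$, then $V(p^t_i(v))\cap V(p^t_j(w))=\emptyset$. *)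

(* Defs.v *)
From HB Require Import structures.
From mathcomp Require Import all_boot all_order all_algebra.
Set Implicit Arguments.
Unset Strict Implicit.
Unset Printing Implicit Defensive.

Record sgraph := SGraph {
  vertex :> finType;
  adj : rel vertex;
  adj_sym : symmetric adj;
  adj_irr : irreflexive adj }.

Definition edges (G : sgraph) : {set {set G}} :=
  [set [set e.1; e.2] | e : G * G & adj e.1 e.2].

Definition deg (G : sgraph) (v : G) : nat := #|[set w | adj v w]|.

Definition max_deg (G : sgraph) : nat := \max_(v : G) deg v.

(* The default value #|G| exceeds every degree, so it is only returned on the
   empty graph. *)
Definition min_deg (G : sgraph) : nat := \big[minn/#|G|]_(v : G) deg v.

Definition deg_class (G : sgraph) (i : nat) : {set G} := [set v | deg v == i].

Definition connected (G : sgraph) : Prop :=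
  0 < #|G| /\ forall x y : G, connect (@adj G) x y.

Section DelEdge.
Variables (G : sgraph) (F : {set G}).

Definition del_adj : rel G := fun x y => adj x y && ([set x; y] != F).

Lemma del_adj_sym : symmetric del_adj.
Proof. by move=> x y; rewrite /del_adj adj_sym setUC. Qed.

Lemma del_adj_irr : irreflexive del_adj.
Proof. by move=> x; rewrite /del_adj adj_irr. Qed.

Definition del_edge : sgraph := SGraph del_adj_sym del_adj_irr.
End DelEdge.

Definition edge_type (G : sgraph) := {F : {set G} | F \in edges G}.

Definition proper_edge_coloring (G : sgraph) (n : nat)
    (c : {ffun edge_type G -> 'I_n}) : bool :=
  [forall F1 : edge_type G, forall F2 : edge_type G,
    (F1 != F2) && (val F1 :&: val F2 != set0) ==> (c F1 != c F2)].

Definition edge_colorable (G : sgraph) (n : nat) : bool :=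
  [exists c : {ffun edge_type G -> 'I_n}, proper_edge_coloring c].

Lemma edge_colorable_ex (G : sgraph) : exists n, edge_colorable G n.
Proof.
exists #|{: edge_type G}|; apply/existsP; exists [ffun F => enum_rank F].
apply/forallP=> F1; apply/forallP=> F2; apply/implyP=> /andP[neqF _].
by rewrite !ffunE (inj_eq enum_rank_inj).
Qed.

Definition chromatic_index (G : sgraph) : nat := ex_minn (edge_colorable_ex G).

Definition critical (k : nat) (G : sgraph) : Prop :=
  [/\ connected G, max_deg G = k, chromatic_index G = k.+1 &
      forall F : {set G}, F \in edges G -> chromatic_index (del_edge F) = k].

Definition independent (G : sgraph) (A : {set G}) : bool :=
  [forall x in A, forall y in A, ~~ adj x y].

Definition indep_num (G : sgraph) : nat :=
  \max_(A : {set G} | independent A) #|A|.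

Definition indep_ratio (G : sgraph) : rat :=
  ((indep_num G)%:R / #|G|%:R)%R.

(* A path is given by the sequence of all its vertices, v included. *)
Definition path_from (G : sgraph) (v : G) (p : seq G) : bool :=
  if p is x :: q then [&& x == v, path (@adj G) x q & uniq p] else false.

Definition class_C (k t : nat) (G : sgraph) : Prop :=
  [/\ critical k G,
      k - 1 <= min_deg G &
      exists p : G -> 'I_(k - 1) -> seq G,
        let V (v : G) (i : 'I_(k - 1)) : {set G} := [set x in p v i] in
        forall v, v \in deg_class G (k - 1) ->
          forall i j : 'I_(k - 1),
          [/\ path_from v (p v i),
              V v i :&: deg_class G (k - 1) = [set v],
              2 * t * (k - 1) + 2 <= #|V v i|,
              i != j -> V v i :&: V v j = [set v] &
              forall w, w \in deg_class G (k - 1) -> w != v ->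
                V v i :&: V w j = set0]].

Definition phi (k t : nat) : nat := t * (k - 1) ^ 2 + (k - 1).

(* Main.v *)
(* Let A be a maximum independent set, B its complement, g the number of
   vertices v of degree k-1 in A whose distinguished paths meet at most once the
   set of vertices of B having a neighbour in B.  The paths of such a v alternate
   between A and B, hence contain phi(k,t) vertices of B; so phi(k,t) g <= |B|.
   Counting the edges between A and B gives k|A| + 2e(B) <= k|B| + |A /\ V_(k-1)|,
   and every other v of A /\ V_(k-1) uses up two ends of edges inside B, so
   k|A| <= k|B| + g, with equality only if e(B) = 0.  But then G is bipartite,
   and a Kempe swap (as in Koenig's edge-colouring theorem) extends a
   k-edge-colouring of G - e to G, contradicting criticality.  The strict
   inequality k|A| < k|B| + g rearranges to the bound. *)
Require Import Defs.
From mathcomp Require Import all_boot all_order all_algebra.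
From mathcomp Require Import zify ring lra.

Set Implicit Arguments.
Unset Strict Implicit.
Unset Printing Implicit Defensive.

(** * Edge colourings as functions on vertex sets *)

(* Colours are attached to vertex sets rather than to the sigma type of edges, so
   that a colouring of G - e is also a function on the edges of G. *)
Definition proper_on (G : sgraph) (n : nat) (c : {set G} -> nat) : Prop :=
  (forall x y : G, adj x y -> c [set x; y] < n) /\
  (forall x y z : G, adj x y -> adj x z -> y != z ->
     c [set x; y] != c [set x; z]).

Lemma adj_neq (G : sgraph) (x y : G) : adj x y -> x != y.
Proof. by apply: contraTneq => ->; rewrite adj_irr. Qed.

Lemma set2_inj (T : finType) (x y z : T) : [set x; y] = [set x; z] -> y = z.
Proof.
move=> e; have: y \in [set x; z] by rewrite -e set22.
rewrite !inE => /orP[/eqP yx|/eqP //].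
have: z \in [set x; y] by rewrite e set22.
by rewrite !inE yx orbb => /eqP.
Qed.

Lemma edges_adj (G : sgraph) (x y : G) : ([set x; y] \in edges G) = adj x y.
Proof.
apply/imsetP/idP => [[[u v]]|a]; last by exists (x, y); rewrite ?inE.
rewrite inE /= => auv e.
have: x \in [set u; v] by rewrite -e set21.
rewrite !inE => /orP[] /eqP xE; subst x; first by rewrite (set2_inj e).
by rewrite [RHS]setUC in e; rewrite (set2_inj e) adj_sym.
Qed.

Lemma edgesP (G : sgraph) (F : {set G}) (x : G) :
  F \in edges G -> x \in F -> exists2 y, adj x y & F = [set x; y].
Proof.
case/imsetP=> -[u v]; rewrite inE /= => auv ->.
rewrite !inE => /orP[] /eqP ->; first by exists v.
by exists u; rewrite 1?adj_sym // setUC.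
Qed.

Lemma edge_colorableP (G : sgraph) (n : nat) :
  edge_colorable G n <-> exists c, @proper_on G n c.
Proof.
split=> [/existsP[c /forallP cP]|[c [c_lt c_neq]]].
  exists (fun F => if insub F is Some E then val (c E) else 0).
  split=> [x y axy|x y z axy axz yz].
    have e : [set x; y] \in edges G by rewrite edges_adj.
    by rewrite insubT; apply: ltn_ord.
  have exy := axy; have exz := axz.
  rewrite -!edges_adj in exy exz; rewrite !insubT.
  pose E w (e : [set x; w] \in edges G) : edge_type G := exist (fun F => F \in edges G) _ e.
  have /forallP/(_ (E _ exz))/implyP := cP (E _ exy); apply.
  rewrite -val_eqE /= (contra_neq (@set2_inj _ _ _ _) yz) /=.
  by apply/set0Pn; exists x; rewrite !inE eqxx.
have c_ltF (E : edge_type G) : c (val E) < n.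
  case: E => F /= EF; have /imsetP[[x y]] := EF.
  by rewrite inE /= => axy ->; apply: c_lt.
apply/existsP; exists [ffun E => Ordinal (c_ltF E)].
apply/forallP=> E1; apply/forallP=> E2; apply/implyP=> /andP[neqE].
case/set0Pn=> x /setIP[x1 x2]; rewrite !ffunE -val_eqE /=.
have [y ay e1] := edgesP (valP E1) x1; have [z az e2] := edgesP (valP E2) x2.
rewrite e1 e2; apply: c_neq => //.
by apply: contra neqE => /eqP yz; rewrite -val_eqE e1 e2 yz.
Qed.

Lemma chromatic_index_colorable (G : sgraph) :
  edge_colorable G (chromatic_index G).
Proof. by rewrite /chromatic_index; case: ex_minnP. Qed.

Lemma chromatic_index_min (G : sgraph) n :
  edge_colorable G n -> chromatic_index G <= n.
Proof. by rewrite /chromatic_index; case: ex_minnP => m _; apply. Qed.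

Lemma leq_max_deg (G : sgraph) (v : G) : deg v <= max_deg G.
Proof. exact: (leq_bigmax (F := @deg G)). Qed.

Lemma min_deg_leq (G : sgraph) (v : G) : min_deg G <= deg v.
Proof.
rewrite /min_deg; have := mem_index_enum v.
elim: index_enum => // x s IH; rewrite inE big_cons => /orP[/eqP<-|/IH].
  exact: geq_minl.
exact/leq_trans/geq_minr.
Qed.

(** Without the edge to [v], fewer than [n] edges remain at [u], so they cannot use up all [n]
    colours. *)
Lemma missing_color (G : sgraph) (u v : G) n c :
  adj u v -> deg u <= n -> @proper_on (del_edge [set u; v]) n c ->
  exists2 i, i < n & forall x, adj u x -> x != v -> c [set u; x] != i.
Proof.
move=> auv du [c_lt c_neq].
pose N := [set x | adj u x & x != v].
have dN x : x \in N -> @adj (del_edge [set u; v]) u x.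
  rewrite inE => /andP[a xv]; rewrite /= /del_adj a /=.
  by apply: contra xv => /eqP /set2_inj ->.
have cN : #|N| < n.
  apply: leq_trans du; rewrite /deg (cardsD1 v [set w | _]) inE auv add1n ltnS.
  by apply: subset_leq_card; apply/subsetP=> x; rewrite !inE andbC.
case: n => // n in c_lt du cN *.
pose M : {set 'I_n.+1} := [set inord (c [set u; x]) | x in N].
have /set0Pn[i iM] : ~: M != set0.
  rewrite -cards_eq0 -lt0n cardsCs setCK card_ord subn_gt0.
  exact: leq_ltn_trans (leq_imset_card _ _) cN.
exists i => // x ax xv; rewrite !inE in iM; apply: contra iM => /eqP e.
by apply/imsetP; exists x; rewrite ?inE ?ax // e inord_val.
Qed.

(** * Kempe swaps in a bipartite graph with one edge removed *)

Section Kempe.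
Variables (G : sgraph) (A : {set G}) (u v : G) (n : nat) (c : {set G} -> nat).
Hypothesis bip : forall x y : G, adj x y -> (x \in A) != (y \in A).
Hypotheses (uA : u \in A) (auv : adj u v).
Let H := del_edge [set u; v].
Hypothesis cP : @proper_on H n c.
Variables i j : nat.
Hypotheses (i_lt : i < n) (j_lt : j < n).
Hypothesis iu : forall x : G, @adj H u x -> c [set u; x] != i.
Hypothesis jv : forall x : G, @adj H v x -> c [set v; x] != j.

(* Two consecutive edges of the (i,j)-Kempe chain starting at u, so that
   kempe_set consists of the vertices of this chain lying in A. *)
Definition kempe_step : rel G := fun x x' => [exists y : G,
  [&& @adj H x y, c [set x; y] == j, @adj H y x' & c [set y; x'] == i]].

Definition kempe_set : {set G} := [set x | connect kempe_step u x].

Definition kempe_swap (a : nat) : nat :=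
  if a == i then j else if a == j then i else a.

Let X := kempe_set.

Lemma kempe_swapK : involutive kempe_swap.
Proof.
rewrite /kempe_swap => a; have [->|ai] := eqVneq a i.
  by rewrite eqxx; case: eqVneq.
by have [->|/negPf->] := eqVneq a j; rewrite ?eqxx // (negPf ai).
Qed.

(** A step crosses two edges of a bipartite graph, so it returns to the side of [u]. This is what
    keeps [v] out of [X]. *)
Lemma kempe_setA : X \subset A.
Proof.
apply/subsetP=> x; rewrite inE => /connectP[p pth ->].
elim: p u uA pth => //= y p IH x0 x0A /andP[/existsP[z /and4P[a1 _ a2 _]]].
apply: IH; case/andP: a1 => /bip + _; case/andP: a2 => /bip + _.
by rewrite x0A; do 2 case: (_ \in A).
Qed.

Lemma kempe_fwd x y x' : x \in X -> @adj H x y -> c [set x; y] = j ->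
  @adj H y x' -> c [set y; x'] = i -> x' \in X.
Proof.
rewrite !inE => cx a1 c1 a2 c2; apply: connect_trans cx (connect1 _).
by apply/existsP; exists y; rewrite a1 c1 a2 c2 !eqxx.
Qed.

Lemma coloring_inj x y z : @adj H x y -> @adj H x z ->
  c [set x; y] = c [set x; z] -> y = z.
Proof.
move=> ay az e; apply/eqP; apply: contraTT isT => /(cP.2 x y z ay az).
by rewrite e eqxx.
Qed.

(** Colour [i] is missing at [u], so [x] was reached by some last step; properness at [x] forces the
    middle vertex of that step to be [y]. *)
Lemma kempe_bwd x y : x \in X -> @adj H x y -> c [set x; y] = i ->
  exists2 x0, x0 \in X & @adj H x0 y /\ c [set x0; y] = j.
Proof.
rewrite inE => /connectP[p]; case/lastP: p => [|p z] /=.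
  by move=> _ -> a /eqP; rewrite (negPf (iu a)).
rewrite rcons_path last_rcons => /andP[pth /existsP[y']].
case/and4P=> a1 /eqP c1 a2 /eqP c2 ->.
move=> a ca; have -> : y = y'.
  apply: (coloring_inj (x := z)) => //; first by rewrite adj_sym.
  by rewrite ca setUC c2.
exists (last u p) => //; rewrite inE; apply/connectP; by exists p.
Qed.

Lemma kempe_jedge x y : x \in X -> @adj H x y -> c [set x; y] \in [:: i; j] ->
  exists2 x0, x0 \in X & @adj H x0 y /\ c [set x0; y] = j.
Proof.
move=> xX a; rewrite !inE => /orP[] /eqP e; first exact: kempe_bwd xX a e.
by exists x.
Qed.

(** The vertex [y] has a [j]-edge to some [x0] in [X]. An [i]-edge from [y] to [x'] continues the
    chain from [x0], while a [j]-edge forces [x' = x0]. *)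
Lemma kempe_closed x y x' : x \in X -> @adj H x y -> @adj H y x' ->
  c [set x; y] \in [:: i; j] -> c [set y; x'] \in [:: i; j] -> x' \in X.
Proof.
move=> xX a1 a2 c1; have [x0 x0X [a0 c0]] := kempe_jedge xX a1 c1.
rewrite in_cons mem_seq1 => /orP[] /eqP e; first exact: kempe_fwd x0X a0 c0 a2 e.
have -> : x' = x0; last by [].
by apply: coloring_inj a2 _ _; rewrite ?(adj_sym y) // e setUC c0.
Qed.

(** This swaps exactly the chain: each of its edges has its end of [A] in [X], and any other edge
    meeting [X] has a colour fixed by the swap. *)
Let recolor (F : {set G}) := if [disjoint F & X] then c F else kempe_swap (c F).

Lemma recolorE x y : recolor [set x; y] =
  if (x \in X) || (y \in X) then kempe_swap (c [set x; y]) else c [set x; y].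
Proof.
rewrite /recolor -setI_eq0 setIUl setU_eq0 !setI_eq0 !disjoints1 -negb_or.
by case: (_ || _).
Qed.

Lemma kempe_swap_lt a : a < n -> kempe_swap a < n.
Proof. by rewrite /kempe_swap; do ! case: ifP. Qed.

(** A clash would give both edges at [z] colours among [i] and [j], and closure of the chain would
    put [b] in [X]. *)
Lemma recolor_boundary_neq z a b : @adj H z a -> @adj H z b -> a \in X ->
  b \notin X -> a != b -> kempe_swap (c [set z; a]) != c [set z; b].
Proof.
move=> az bz aX bX ab; have [cij|cij] := boolP (c [set z; a] \in [:: i; j]).
  apply: contra bX => /eqP e; apply: (kempe_closed aX _ bz).
  - by rewrite adj_sym.
  - by rewrite setUC.
  rewrite -e /kempe_swap !inE; move: cij; rewrite !inE.
  by do ! case: eqP => //= ?; rewrite ?eqxx ?orbT.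
rewrite /kempe_swap; move: cij; rewrite !inE negb_or => /andP[/negPf-> /negPf->].
exact: cP.2.
Qed.

Lemma recolor_neq z a b : @adj H z a -> @adj H z b -> a != b ->
  recolor [set z; a] != recolor [set z; b].
Proof.
move=> az bz ab; rewrite !recolorE.
have swap_neq : kempe_swap (c [set z; a]) != kempe_swap (c [set z; b]).
  by rewrite (inj_eq (inv_inj kempe_swapK)); apply: cP.2.
have [//|_] := boolP (z \in X) => /=.
have [aX|aX] := boolP (a \in X); have [bX|bX] := boolP (b \in X) => //.
- exact: recolor_boundary_neq.
- by rewrite eq_sym; apply: recolor_boundary_neq => //; rewrite eq_sym.
- exact: cP.2.
Qed.

(** The swap turns the colour missing at [u] from [i] into [j]. At [v], a new [j] would come from an
    [i]-edge to a vertex of [X]; the chain would then have entered [v] by a [j]-edge, but [j] is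
    missing there. *)
Lemma kempe_new_edge z a : z \in [set u; v] -> @adj H z a -> recolor [set z; a] != j.
Proof.
have uX : u \in X by rewrite inE connect0.
rewrite !inE recolorE => /orP[] /eqP-> aza.
  (* Reading [j] as [kempe_swap i] reduces the claim to the absence of [i] before the swap. *)
  rewrite uX /= -[j in X in _ != X](_ : kempe_swap i = j).
    by rewrite (inj_eq (inv_inj kempe_swapK)) iu.
  by rewrite /kempe_swap eqxx.
have vX : v \notin X.
  by apply: contra (bip auv) => /(subsetP kempe_setA) ->; rewrite uA.
rewrite (negPf vX) /=; case: ifP => aX; last exact: jv.
rewrite -[j in X in _ != X](_ : kempe_swap i = j); last first.
  by rewrite /kempe_swap eqxx.
rewrite (inj_eq (inv_inj kempe_swapK)); apply/eqP => e.
have a' : @adj H a v by rewrite adj_sym.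
have [|x0 _ [a0 c0]] := kempe_jedge aX a'; first by rewrite setUC e mem_head.
have := jv (x := x0); rewrite adj_sym setUC c0 eqxx => /(_ a0); by [].
Qed.

Lemma kempe_extend : exists c', @proper_on G n c'.
Proof.
exists (fun F => if F == [set u; v] then j else recolor F).
have adjH x y : adj x y -> [set x; y] != [set u; v] -> @adj H x y.
  by move=> a ne; rewrite /= /del_adj a.
split=> [x y axy|x y z axy axz yz].
  case: eqVneq => // /(adjH _ _ axy)/cP.1; rewrite /recolor.
  by case: ifP => // _; apply: kempe_swap_lt.
have [e1|n1] := eqVneq [set x; y] [set u; v];
  have [e2|n2] := eqVneq [set x; z] [set u; v].
- by move: e1; rewrite -e2 => /set2_inj /eqP; rewrite (negPf yz).
- rewrite eq_sym; apply: kempe_new_edge; last exact: adjH.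
  by rewrite -e1 set21.
- by apply: kempe_new_edge; [rewrite -e2 set21|apply: adjH].
- by apply: recolor_neq => //; apply: adjH.
Qed.

End Kempe.

Lemma bipartite_extend (G : sgraph) (A : {set G}) (u v : G) n :
  (forall x y : G, adj x y -> (x \in A) != (y \in A)) -> adj u v ->
  max_deg G <= n -> edge_colorable (del_edge [set u; v]) n -> edge_colorable G n.
Proof.
move=> bip; wlog uA : u v / u \in A => [IH auv|].
  have [uA|uA] := boolP (u \in A); first exact: IH.
  rewrite setUC; apply: IH; last by rewrite adj_sym.
  by move: (bip _ _ auv); rewrite (negPf uA); case: (v \in A).
move=> auv dG /edge_colorableP[c cP]; apply/edge_colorableP.
have dn (x : G) : deg x <= n by exact: leq_trans (leq_max_deg x) dG.
have [i i_lt iu] := missing_color auv (dn u) cP.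
have avu : adj v u by rewrite adj_sym.
have cP' : @proper_on (del_edge [set v; u]) n c by rewrite setUC.
have [j j_lt jv] := missing_color avu (dn v) cP'.
apply: (kempe_extend bip uA auv cP i_lt j_lt) => x /andP[a ne].
- by apply: iu => //; apply: contra ne => /eqP->.
- by apply: jv => //; apply: contra ne => /eqP->; rewrite setUC.
Qed.

(** * Double counting and alternating paths *)

Lemma sum_card_disjoint (T I : finType) (P : pred I) (F : I -> {set T})
    (S : {set T}) :
  (forall i, P i -> F i \subset S) ->
  (forall i j, P i -> P j -> i != j -> F i :&: F j = set0) ->
  \sum_(i | P i) #|F i| <= #|S|.
Proof.
move=> FS dis; under eq_bigr => i Pi do rewrite -sum1_card big_mkcond.
rewrite exchange_big /= -sum1_card [leqRHS]big_mkcond /=.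
apply: leq_sum => x _.
have [/existsP[i /andP[Pi xi]]|no] := boolP [exists i, P i && (x \in F i)]; last first.
  rewrite big1 // => i Pi; case: ifP => // xi.
  by case/existsP: no; exists i; rewrite Pi.
rewrite (subsetP (FS i Pi) _ xi) (bigD1 i) //= xi big1 // => j /andP[Pj ji].
case: ifP => // xj; have := dis _ _ Pj Pi ji.
by move/setP/(_ x); rewrite !inE xj xi.
Qed.

(** The start [x] is not counted: if [a x] holds, the first vertex of [q] is already outside [a],
    hence the rounding up. *)
Lemma alternating_path_count (T : eqType) (a : pred T) (x : T) (q : seq T) :
  path (fun y z => a y != a z) x q ->
  count (predC a) q = if a x then uphalf (size q) else (size q)./2.
Proof.
elim: q x => [|y q IH] x /=; first by case: ifP.
by case/andP=> + /IH ->; do 2 case: (a _).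
Qed.

Section Counting.
Variables (G : sgraph) (A : {set G}).
Hypothesis indepA : independent A.

(** Summed over [~: A], the cardinalities of these sets give twice the number of edges inside
    [~: A]. *)
Definition inner_nbrs (y : G) : {set G} := [set x in ~: A | adj y x].
Definition inner_set : {set G} := [set y in ~: A | inner_nbrs y != set0].

Lemma independent_adjF x y : x \in A -> y \in A -> adj x y = false.
Proof.
move: indepA => /forallP/(_ x)/implyP h xA yA.
by have /forallP/(_ y)/implyP/(_ yA)/negPf := h xA.
Qed.

(** The edges between [A] and its complement are counted from both sides; [A] has no edges
    inside. *)
Lemma sum_deg_independent :
  \sum_(x in A) deg x + \sum_(y in ~: A) #|inner_nbrs y| = \sum_(y in ~: A) deg y.
Proof.
have degE (x : G) : deg x = \sum_(y in A) adj x y + \sum_(y in ~: A) adj x y.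
  rewrite /deg -sum1_card big_mkcond /= (bigID (mem A)) /=; congr (_ + _).
    by apply: eq_bigr => y _; rewrite inE; case: adj.
  by apply: eq_big => [y|y _]; rewrite inE //; case: adj.
have -> : \sum_(x in A) deg x = \sum_(x in A) \sum_(y in ~: A) adj x y.
  apply: eq_bigr => x xA; rewrite degE big1 // => y yA.
  by rewrite independent_adjF.
rewrite exchange_big /= -big_split; apply: eq_bigr => y yA.
rewrite degE; congr (_ + _); first by apply: eq_bigr => x _; rewrite adj_sym.
rewrite -sum1_card big_mkcond [RHS]big_mkcond /=; apply: eq_bigr => x _.
by rewrite !inE; case: (x \in A) => //=; case: adj.
Qed.

Lemma card_inner_set : #|inner_set| <= \sum_(y in ~: A) #|inner_nbrs y|.
Proof.
rewrite -sum1_card [leqRHS](bigID (fun y => inner_nbrs y != set0)) /=.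
apply: leq_trans (leq_addr _ _).
under eq_bigl do rewrite inE; apply: leq_sum => y /andP[_].
by rewrite card_gt0.
Qed.

Lemma inner_nbrs_bipartite : \sum_(y in ~: A) #|inner_nbrs y| = 0 ->
  forall x y : G, adj x y -> (x \in A) != (y \in A).
Proof.
move=> /eqP; rewrite sum_nat_eq0 => /forallP D0 x y axy.
have [xA|xA] := boolP (x \in A); have [yA|yA] := boolP (y \in A) => //.
  by rewrite independent_adjF in axy.
move/implyP/(_ _): (D0 x); rewrite inE xA => /(_ isT).
by rewrite cards_eq0 => /eqP/setP/(_ y); rewrite !inE yA axy.
Qed.

Lemma path_card_outside (v : G) (p : seq G) T :
  path_from v p -> v \in A -> 2 * T + 2 <= #|[set x in p]| ->
  #|[set x in p] :&: inner_set| <= 1 -> T.+1 <= #|[set x in p] :&: ~: A|.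
Proof.
case: p => // x q /and3P[/eqP-> pth uq] vA.
rewrite {1}cardsE (card_uniqP uq) /= => szq inner1.
have : path (fun y z => (y \in A) != (z \in A)) v q.
  apply: (sub_in_path (P := mem (v :: q))) pth; last exact/allP.
  move=> y z yp zp ayz; have [yA|yA] := boolP (y \in A);
    have [zA|zA] := boolP (z \in A) => //; first by rewrite independent_adjF in ayz.
  (* Two consecutive vertices outside [A] would be two distinct vertices of [inner_set] on the
     path. *)
  have yz := adj_neq ayz; move: inner1; rewrite leqNgt => /negP[].
  rewrite -[2](_ : #|[set y; z]| = 2); last by rewrite cards2 yz.
  apply: subset_leq_card; apply/subsetP=> w; rewrite !inE => /orP[] /eqP-> /=.
    move: yp; rewrite inE => ->; rewrite yA; apply/set0Pn; exists z.
    by rewrite !inE zA.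
  move: zp; rewrite inE => ->; rewrite zA; apply/set0Pn; exists y.
  by rewrite !inE yA adj_sym.
move/(@alternating_path_count _ (mem A)); rewrite /= vA => cnt.
have -> : #|[set x in v :: q] :&: ~: A| = count (predC (mem A)) q.
  have uqF : uniq [seq w <- q | predC (mem A) w].
    by rewrite filter_uniq //; case/andP: uq.
  rewrite -size_filter -(card_uniqP uqF).
  apply: eq_card => w; rewrite !inE mem_filter /=.
  by case: eqVneq => [->|_]; rewrite ?vA ?andbF // andbC.
(* At least [2 * T + 1] vertices follow [v], and half of that, rounded up, is [T.+1]. *)
rewrite cnt; lia.
Qed.

End Counting.

(** * Criticality, arithmetic of the bound, and conclusion *)

Lemma indep_num_witness (G : sgraph) :
  exists2 A : {set G}, independent A & #|A| = indep_num G.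
Proof.
have P0 : 0 < #|[pred A : {set G} | independent A]|.
  apply/card_gt0P; exists set0; rewrite inE.
  by apply/forallP=> x; rewrite inE.
have [A iA e] := eq_bigmax_cond (fun A : {set G} => #|A|) P0.
by exists A; last by rewrite /indep_num -e.
Qed.

Lemma critical_not_bipartite (k : nat) (G : sgraph) (A : {set G}) :
  0 < k -> critical k G ->
  ~ (forall x y : G, adj x y -> (x \in A) != (y \in A)).
Proof.
move=> k0 [[G0 _] dG chiG crit] bip.
have [u [v auv]] : exists u v : G, adj u v.
  have [u du] := eq_bigmax (@deg G) G0; exists u.
  have /card_gt0P[v] : 0 < #|[set w | adj u w]|.
    by rewrite -/(deg u) -du -/(max_deg G) dG.
  by rewrite inE; exists v.
have eF : [set u; v] \in edges G by rewrite edges_adj.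
have := chromatic_index_colorable (del_edge [set u; v]); rewrite crit //.
rewrite -{1}dG => /(bipartite_extend bip auv (leqnn _)) /chromatic_index_min.
by rewrite chiG dG ltnn.
Qed.

(** The right-hand side equals [K.+1 / (2 * K + 1)]; cross-multiplying and cancelling [K * a] leaves
    the hypothesis. *)
Lemma ratio_ltr_half (K a m : nat) : K * a < K.+1 * m ->
  (a%:R / (a + m)%:R < 1 / 2%:R + 1 / (4 * K + 2)%N%:R :> rat)%R.
Proof.
move=> key; have am0 : 0 < a + m by case: m key => [|m]; rewrite ?muln0 ?addnS.
have -> : (1 / 2%:R + 1 / (4 * K + 2)%N%:R = K.+1%:R / (2 * K + 1)%N%:R :> rat)%R.
  have K0 : (0 <= K%:R :> rat)%R by apply: Num.Theory.ler0n.
  rewrite -[K.+1]addn1 [(K + 1)%:R%R]GRing.natrD.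
  rewrite (GRing.natrD _ (4 * K)) (GRing.natrD _ (2 * K)) !GRing.natrM; field.
  by rewrite !Num.Theory.lt0r_neq0 //; lra.
rewrite Num.Theory.ltr_pdivrMr ?Num.Theory.ltr0n //.
rewrite GRing.mulrAC Num.Theory.ltr_pdivlMr ?Num.Theory.ltr0n ?addn1 //.
rewrite -!GRing.natrM Num.Theory.ltr_nat; lia.
Qed.

Theorem theorem2p10 (k t : nat) (G : sgraph) (hk : 2 <= k)
    (hG : class_C k t G) :
  (indep_ratio G < 1 / 2%:R + 1 / (4 * k * phi k t + 2)%N%:R)%R.
Proof.
case: hG => crit mind [p pP].
have [A iA cA] := indep_num_witness G.
have nbip := critical_not_bipartite (ltnW hk) crit (A := A).
have [[G0 _] dG _ _] := crit.
pose D := deg_class G (k - 1); pose S := A :&: D.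
pose P (v : G) := \bigcup_(i < k - 1) [set x in p v i].
pose I := inner_set A; pose g := [pred v | #|P v :&: I| <= 1].
pose e2 := \sum_(y in ~: A) #|inner_nbrs A y|.
have dk (x : G) : deg x <= k by rewrite -dG; apply: leq_max_deg.
have P_disj v w : v \in S -> w \in S -> v != w -> P v :&: P w = set0.
  case/setIP=> _ vD /setIP[_ wD] vw; apply/setP=> x; rewrite !inE.
  apply/negbTE/negP=> /andP[/bigcupP[i _ xi] /bigcupP[j _ xj]].
  have [_ _ _ _ /(_ w wD)] := pP v vD i j; rewrite eq_sym => /(_ vw)/setP/(_ x).
  by rewrite inE xi xj inE.
have e2_pos : 0 < e2.
  by rewrite lt0n; apply/eqP=> /(inner_nbrs_bipartite iA)/nbip.
have count_deg : k * #|A| + e2 <= k * #|~: A| + #|S|.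
  (* Degrees are [k] or [k - 1], so the only deficit in [A] is one unit for each vertex of [S]. *)
  have hA : k * #|A| <= \sum_(x in A) deg x + #|S|.
    rewrite mulnC -sum_nat_const -[#|S|]sum1_card (big_setID D) /=.
    rewrite [in leqRHS](big_setID D) /= addnAC -big_split /=.
    apply: leq_add; apply: leq_sum => x; rewrite !inE.
      by case/andP=> _ /eqP ->; lia.
    case/andP=> xD _; have := leq_trans mind (min_deg_leq x); have := dk x.
    by lia.
  have hB : \sum_(y in ~: A) deg y <= k * #|~: A|.
    by rewrite mulnC -sum_nat_const; apply: leq_sum.
  have := sum_deg_independent iA; rewrite -/e2; lia.
(* For a vertex failing [g], [P v] contains two vertices of [I], and these sets are disjoint for
   distinct vertices of [S]. *)
have bad_le : 2 * #|S :\: [set v | g v]| <= e2.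
  apply: leq_trans (card_inner_set A); rewrite mulnC -sum_nat_const.
  apply: (@leq_trans (\sum_(v in S :\: [set v | g v]) #|P v :&: I|)).
    by apply: leq_sum => v; rewrite !inE -ltnNge => /andP[].
  apply: sum_card_disjoint => [v _|v w]; first exact: subsetIr.
  case/setDP=> vS _ /setDP[wS _] vw.
  by rewrite setIACA (P_disj v w) // set0I.
have good_le : phi k t * #|S :&: [set v | g v]| <= #|~: A|.
  rewrite mulnC -sum_nat_const.
  apply: (@leq_trans (\sum_(v in S :&: [set v | g v]) #|P v :&: ~: A|)); last first.
    apply: sum_card_disjoint => [v _|v w]; first exact: subsetIr.
    case/setIP=> vS _ /setIP[wS _] vw.
    by rewrite setIACA (P_disj v w) // set0I.
  apply: leq_sum => v /setIP[/setIP[vA vD]]; rewrite inE /= => gv.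
  (* Factored as [(k - 1) * (t * (k - 1) + 1)], [phi k t] is one share of [t * (k - 1) + 1] outside
     vertices per path. *)
  have -> : phi k t = \sum_(i < k - 1) (t * (k - 1)).+1.
    by rewrite sum_nat_const card_ord /phi; ring.
  apply: (@leq_trans (\sum_(i < k - 1) #|[set x in p v i] :&: ~: A|)).
    apply: leq_sum => i _; have [pf _ sz _ _] := pP v vD i i.
    apply: (path_card_outside iA pf vA); first by rewrite mulnA.
    apply: leq_trans gv; apply/subset_leq_card/setSI; exact: bigcup_sup.
  (* Two paths from [v] share only [v], which lies in [A], so their parts outside [A] are
     disjoint. *)
  apply: sum_card_disjoint => [i _|i j _ _ ij]; first exact/setSI/bigcup_sup.
  have [_ _ _ /(_ ij) e _] := pP v vD i j; rewrite setIACA e setIid.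
  by apply/setP=> x; rewrite !inE; case: eqP => // ->; rewrite vA.
have key : phi k t * (k * #|A|) < (phi k t * k).+1 * #|~: A|.
  have S_split := cardsID [set v | g v] S.
  (* Here [e2] exceeds the number of vertices of [S] failing [g]: it is at least twice that number,
     and positive if there are none. *)
  have lt1 : k * #|A| < k * #|~: A| + #|S :&: [set v | g v]| by lia.
  have phi0 : 0 < phi k t by rewrite /phi; lia.
  move: lt1; rewrite -(ltn_pmul2l phi0) mulnDr => /leq_trans; apply.
  by rewrite mulSn mulnA addnC leq_add2r.
rewrite /indep_ratio -cA -(cardsC A).
have -> : 4 * k * phi k t + 2 = 4 * (phi k t * k) + 2 by ring.
by apply: ratio_ltr_half; rewrite // -mulnA.
Qed.
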